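(* Let $T$ be a finite rooted tree with root $r$ whose children are $r_1,\dots,r_k$, and let $T^1,\dots,T^k$ be the subtrees of $T$ rooted at $r_1,\dots,r_k$. For a finite rooted tree $S$ let $\bar S$ be the multigraph obtained by identifying all leaves of $S$ to a single sink vertex (keeping all edges) and adding one edge from the root of $S$ to the sink. Then \[ SP(\bar T)/\langle \hat r\rangle \;\simeq\; \Bigl(\bigoplus_{i=1}^k SP(\bar{T^i})\Bigr)\Big/\langle (\hat r_1,\dots,\hat r_k)\rangle, \] where $\langle\hat r\rangle$ is the cyclic subgroup of $SP(\bar T)$ generated by $\hat r$, and $\langle(\hat r_1,\dots,\hat r_k)\rangle$ is the cyclic subgroup of $\bigoplus_i SP(\bar{T^i})$ generated by $(\hat r_1,\dots,\hat r_k)$.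
   Context: For a finite multigraph $G$ (no loops) with sink $s$: a chip configuration is a function from non-sink vertices to $\mathbb{Z}_{\ge 0}$; a non-sink vertex $x$ with at least $\deg(x)$ chips may topple, sending one chip along each incident edge (chips reaching $s$ disappear); every configuration $u$ stabilizes to a unique stable configuration $u^\circ$. A stable $u$ is recurrent if $(u+v)^\circ=u$ for some nonzero configuration $v$. The sandpile group $SP(G)=\mathbb{Z}^{N-1}/\Delta\mathbb{Z}^{N-1}$ ($\Delta$ the reduced Laplacian with sink row/column removed, $\Delta_{ii}=-\deg(x_i)$, $\Delta_{ij}$ = number of edges between $x_i,x_j$) is identified with the set of recurrent configurations (each class has a unique recurrent representative) under the operation $(u,v)\mapsto (u+v)^\circ$. Let $e$ be the identity element (the recurrent representative of $0$). For a non-sink vertex $x$, $\delta_x$ denotes one chip at $x$ and $\hat x = (e+\delta_x)^\circ$ is its recurrent representative. *)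

(* Defs.v *)
From HB Require Import structures.
From mathcomp Require Import all_boot all_order all_algebra.
From mathcomp Require Import ring_quotient boolp classical_sets.

Set Implicit Arguments.
Unset Strict Implicit.
Unset Printing Implicit Defensive.

Import GRing.Theory.
Local Open Scope ring_scope.

(** ** Abelian groups: cyclic subgroups, direct sums, isomorphism *)

Definition multiples (A : zmodType) (g : A) : {pred A} :=
  fun x => `[< exists n : int, x = g *~ n >].

Fact multiples_zmod_closed (A : zmodType) (g : A) : zmod_closed (multiples g).
Proof.
split; first by apply/asboolP; exists 0; rewrite mulr0z.
move=> x y /asboolP[m ->] /asboolP[n ->].
by apply/asboolP; exists (m - n); rewrite mulrzBr.
Qed.

HB.instance Definition _ (A : zmodType) (g : A) :=
  GRing.isZmodClosed.Build A (multiples g) (multiples_zmod_closed g).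

Definition quot_cyclic (A : zmodType) (g : A) : zmodType :=
  Quotient.quot (multiples g).

Section DirectSum.
Variables (I : finType) (A : I -> zmodType).

Definition dsum : Type := {dffun forall i, A i}.

HB.instance Definition _ := Choice.on dsum.

Definition dsum_zero : dsum := [ffun i => 0 : A i].
Definition dsum_opp (u : dsum) : dsum := [ffun i => - u i].
Definition dsum_add (u v : dsum) : dsum := [ffun i => u i + v i].

Fact dsum_addA : associative dsum_add.
Proof. by move=> u v w; apply/ffunP=> i; rewrite !ffunE addrA. Qed.
Fact dsum_addC : commutative dsum_add.
Proof. by move=> u v; apply/ffunP=> i; rewrite !ffunE addrC. Qed.
Fact dsum_add0 : left_id dsum_zero dsum_add.
Proof. by move=> u; apply/ffunP=> i; rewrite !ffunE add0r. Qed.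
Fact dsum_addN : left_inverse dsum_zero dsum_opp dsum_add.
Proof. by move=> u; apply/ffunP=> i; rewrite !ffunE addNr. Qed.

HB.instance Definition _ :=
  GRing.isZmodule.Build dsum dsum_addA dsum_addC dsum_add0 dsum_addN.

Definition tuple_dsum (g : forall i, A i) : dsum := [ffun i => g i].

End DirectSum.

Definition zmod_isog (A B : zmodType) : Prop :=
  exists f : {additive A -> B}, bijective f.

(** ** Sandpiles on a finite loopless multigraph with a sink *)

Record multigraph := Multigraph {
  vertex : finType;
  sink : vertex;
  mult : vertex -> vertex -> nat;
  mult_sym : forall x y, mult x y = mult y x;
  mult_irr : forall x, mult x x = 0%N
}.

Section Sandpile.
Variable G : multigraph.

Definition site : finType := {x : vertex G | x != sink G}.

Definition deg (x : vertex G) : nat := (\sum_(y : vertex G) mult x y)%N.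

Definition config := {ffun site -> nat}.

Definition stable (u : config) : bool := [forall x : site, u x < deg (val x)]%N.

(* Since [mult x x = 0], the toppled site loses exactly [deg x] chips. *)
Definition topple (x : site) (u : config) : config :=
  [ffun y => if y == x then u y - deg (val x) else u y + mult (val x) (val y)]%N.

Definition legal_step (u w : config) : bool :=
  [exists x : site, (deg (val x) <= u x)%N && (w == topple x u)].

Definition stabilizes_to (u w : config) : Prop :=
  stable w /\ exists s : seq config, path legal_step u s /\ last u s = w.

(* [xget] returns an element satisfying the predicate as soon as there is one.
   Its default value (here [u], and [0] in [identity] below) is never used when
   the graph is connected and the sites span a nonempty connected subgraph,
   which is the case for wired trees. *)
Definition stabilize (u : config) : config :=
  xget u (fun w => stabilizes_to u w).

Definition recurrent (u : config) : Prop :=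
  stable u /\ exists v : config, v != 0 /\ stabilize (u + v) = u.

Definition reduced_laplacian (x y : site) : int :=
  if x == y then - (deg (val x))%:Z else (mult (val x) (val y))%:Z.

Definition laplacian_lattice : {pred {ffun site -> int}} := fun u =>
  `[< exists v : {ffun site -> int},
        u = [ffun x => \sum_(y : site) reduced_laplacian x y * v y] >].

Fact laplacian_lattice_zmod_closed : zmod_closed laplacian_lattice.
Proof.
split.
  apply/asboolP; exists 0; apply/ffunP=> x; rewrite !ffunE big1 // => y _.
  by rewrite ffunE mulr0.
move=> _ _ /asboolP[v ->] /asboolP[w ->]; apply/asboolP; exists (v - w).
apply/ffunP=> x; rewrite !ffunE -sumrB; apply: eq_bigr => y _.
by rewrite !ffunE mulrBr.
Qed.

HB.instance Definition _ := GRing.isZmodClosed.Build {ffun site -> int}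
  laplacian_lattice laplacian_lattice_zmod_closed.

Definition SP : zmodType := Quotient.quot laplacian_lattice.

Definition class_of (u : config) : SP :=
  \pi_(Quotient.quot laplacian_lattice)%qT [ffun x => (u x)%:Z].

Definition identity : config :=
  xget 0 (fun e => recurrent e /\ class_of e = 0).

Definition delta (x : site) : config := [ffun y => (y == x) : nat].

Definition hat (x : site) : config := stabilize (identity + delta x).

Definition hat_class (x : site) : SP := class_of (hat x).

End Sandpile.

(** ** Finite rooted trees *)

(* The root is its own parent by convention; acyclicity follows from the
   requirement that iterating [parent] from any node ends at the root. *)
Record rooted_tree := RootedTree {
  node :> finType;
  tree_root : node;
  parent : node -> node;
  parent_root : parent tree_root = tree_root;
  parent_connect : forall x, fconnect parent x tree_root
}.

Section TreeDefs.
Variable T : rooted_tree.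
Implicit Types x y : T.

Definition is_child y x : bool := (y != tree_root T) && (parent y == x).

Definition child x : finType := {y : T | is_child y x}.

(* A leaf is a node without children other than the root: the root is never a
   leaf, so that the root of a wired tree is never the sink, including for the
   tree with a single node, whose wired tree has one edge and a trivial SP. *)
Definition leaf x : bool := (x != tree_root T) && [forall y, ~~ is_child y x].

Definition adj x y : bool := is_child x y || is_child y x.

Definition descendant c x : bool := fconnect (@parent T) x c.

Lemma parent_fixed x : parent x = x -> x = tree_root T.
Proof.
move=> fx; have /iter_findex <- := parent_connect x.
by elim: findex => //= n <-.
Qed.

Lemma adj_irr x : ~~ adj x x.
Proof.
rewrite /adj orbb /is_child; apply/negP => /andP[xr /eqP /parent_fixed xe].
by rewrite xe eqxx in xr.
Qed.

Lemma adj_sym x y : adj x y = adj y x.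
Proof. exact: orbC. Qed.

Lemma adj_leaf x y : leaf x -> leaf y -> ~~ adj x y.
Proof.
by move=> /andP[_ /forallP lx] /andP[_ /forallP ly]; rewrite negb_or lx ly.
Qed.

End TreeDefs.

(** ** The subtree of descendants of a node *)

Section Subtree.
Variables (T : rooted_tree) (c : T).

Definition subtree_node : finType := {x : T | descendant c x}.

Definition subtree_root : subtree_node := exist _ c (connect0 _ c).

(* [parent x] is again a descendant of [c] for every descendant [x != c]. *)
Definition subtree_parent (x : subtree_node) : subtree_node :=
  if x == subtree_root then subtree_root
  else insubd subtree_root (parent (val x)).

Fact subtree_parent_root : subtree_parent subtree_root = subtree_root.
Proof. by rewrite /subtree_parent eqxx. Qed.

Fact subtree_parent_connect x : fconnect subtree_parent x subtree_root.
Proof.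
case: x => x dx; have /iter_findex := dx; move: (findex _ _ _) => n.
elim: n x dx => [|n IH] x dx.
  by move=> /= xc; rewrite (_ : exist _ _ _ = subtree_root) //; apply: val_inj.
rewrite iterSr => it.
have dp : descendant c (parent x) by rewrite -it; exact: fconnect_iter.
have [->|ne] := eqVneq (exist _ x dx : subtree_node) subtree_root.
  exact: connect0.
apply: connect_trans (IH _ dp it); apply: connect1; rewrite /= /subtree_parent.
rewrite (negPf ne); apply/eqP/val_inj.
by rewrite val_insubd /= (_ : descendant c _ = true).
Qed.

Definition subtree : rooted_tree :=
  RootedTree subtree_parent_root subtree_parent_connect.

End Subtree.

(** ** The wired tree *)

Section WiredTree.
Variable T : rooted_tree.

(* [None] is the sink, to which all the leaves are identified. *)
Definition wired_vertex : finType := option {x : T | ~~ leaf x}.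

Definition collapse (x : T) : wired_vertex := insub x.

Fact root_nleaf : ~~ leaf (tree_root T).
Proof. by rewrite /leaf eqxx. Qed.

Definition wired_root_vertex : wired_vertex :=
  Some (exist _ (tree_root T) root_nleaf).

(* An edge between distinct vertices [p] and [q] of the wired tree is
   counted once, as the ordered pair whose first component is collapsed to [p]. *)
Definition wired_mult (p q : wired_vertex) : nat :=
  (#|[pred ab : T * T | [&& adj ab.1 ab.2, collapse ab.1 == p
                          & collapse ab.2 == q]]|
   + ((p == wired_root_vertex) && (q == None)
      || (p == None) && (q == wired_root_vertex)))%N.

Fact wired_mult_sym p q : wired_mult p q = wired_mult q p.
Proof.
rewrite /wired_mult; congr (_ + _)%N; last by rewrite orbC !(andbC (_ == None)).
have swK : involutive (fun ab : T * T => (ab.2, ab.1)) by case.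
rewrite -(card_image (inv_inj swK)); apply: eq_card => ab.
rewrite -[ab]swK fintype.mem_image ?inE /=; last exact: inv_inj.
by rewrite adj_sym [X in _ && X]andbC.
Qed.

Fact wired_mult_irr p : wired_mult p p = 0%N.
Proof.
have -> : wired_mult p p = #|[pred ab : T * T | [&& adj ab.1 ab.2,
    collapse ab.1 == p & collapse ab.2 == p]]|.
  by rewrite /wired_mult; case: p => [x|]; rewrite ?andbF ?addn0.
apply: eq_card0 => -[a b]; rewrite !inE /=; apply/and3P => -[ab /eqP ap /eqP bp].
have := ab; rewrite (_ : b = a) ?(negPf (adj_irr _)) //.
move: ap bp; rewrite /collapse; case: insubP => [x _ <- <-|la <-].
  by case: insubP => // y _ <- [->].
case: insubP => // lb _.
by have := adj_leaf (negbNE la) (negbNE lb); rewrite ab.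
Qed.

Definition wired_tree : multigraph :=
  @Multigraph wired_vertex None wired_mult wired_mult_sym wired_mult_irr.

Definition wired_root : site wired_tree :=
  exist (fun x : wired_vertex => x != None) wired_root_vertex isT.

Definition root_hat : SP wired_tree := hat_class wired_root.

End WiredTree.

(* Main.v *)
(** Both quotients are images of the functions [w : T -> int] on all the nodes
    of [T], and the two surjections have the same kernel.  A function [w] dies
    in [SP(T)] modulo the root exactly when, for some [V] vanishing on the
    leaves, [w] is the Laplacian of [V] at every internal node other than the
    root: the equation at the root [r] is absorbed by the multiple of [r].  On
    the side of the subtrees, wiring the root [c] of a subtree to the sink
    replaces the term [V r] in the equation at [c] by [0], so that the multiple
    [n] of the generators [(r_1, ..., r_k)], common to all the subtrees, plays
    the role of the value [V r]. *)

Require Import Defs.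
From HB Require Import structures.
From mathcomp Require Import all_boot all_order all_algebra.
From mathcomp Require Import ring_quotient boolp classical_sets.
From mathcomp Require Import ring.

Set Implicit Arguments.
Unset Strict Implicit.
Unset Printing Implicit Defensive.

Import GRing.Theory.
Local Open Scope ring_scope.

(** * Quotients and direct sums of abelian groups *)

Definition proj (A : zmodType) (I : zmodClosed A) (x : A) : Quotient.quot I :=
  (\pi_(Quotient.quot I) x)%qT.

Fact proj_is_zmod_morphism (A : zmodType) (I : zmodClosed A) :
  zmod_morphism (@proj A I).
Proof. by move=> x y; rewrite /proj raddfB. Qed.

HB.instance Definition _ (A : zmodType) (I : zmodClosed A) :=
  GRing.isZmodMorphism.Build A (Quotient.quot I) (@proj A I)
    (proj_is_zmod_morphism I).

Lemma proj_eq (A : zmodType) (I : zmodClosed A) (x y : A) :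
  proj I x = proj I y <-> x - y \in I.
Proof. by rewrite Quotient.idealrBE; split => [/eqP|/eqP]. Qed.

Lemma proj_surj (A : zmodType) (I : zmodClosed A) (q : Quotient.quot I) :
  exists x, proj I x = q.
Proof. by exists (repr q); rewrite /proj reprK. Qed.

Lemma proj_cyclic_eq0 (A : zmodType) (g x : A) :
  proj (multiples g) x = 0 <-> exists n : int, x = g *~ n.
Proof.
rewrite -(raddf0 (proj (multiples g))) proj_eq subr0.
by split => [/asboolP|H] //; apply/asboolP.
Qed.

(** Equal kernels mean that [f] and [g] identify the same pairs, so a chosen section of [f] followed
    by [g] is additive, with inverse a section of [g] followed by [f]. *)
Lemma zmod_isog_same_kernel (A B C : zmodType) (f : {additive A -> B})
    (g : {additive A -> C}) :
  (forall b, exists a, f a = b) -> (forall c, exists a, g a = c) ->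
  (forall a, f a = 0 <-> g a = 0) -> zmod_isog B C.
Proof.
move=> fS gS fg.
have fgE a a' : f a = f a' <-> g a = g a'.
  by split=> /eqP; rewrite -subr_eq0 -raddfB => /eqP /fg /eqP;
    rewrite raddfB subr_eq0 => /eqP.
pose s b := projT1 (cid (fS b)); have sK b : f (s b) = b by rewrite /s; case: cid.
pose t c := projT1 (cid (gS c)); have tK c : g (t c) = c by rewrite /t; case: cid.
have hB : zmod_morphism (g \o s).
  move=> x y /=; rewrite -raddfB; apply/fgE.
  by rewrite raddfB !sK.
pose h : {additive B -> C} := HB.pack (g \o s) (GRing.isZmodMorphism.Build _ _ _ hB).
exists h; exists (f \o t) => x /=.
  by rewrite -[RHS]sK; apply/fgE; rewrite tK.
by rewrite -[RHS]tK; apply/fgE; rewrite sK.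
Qed.

Section DirectSum.
Variables (I : finType) (A : I -> zmodType).

(** Made an additive map below, so that integer multiples can be read coordinatewise. *)
Definition dsum_coord (i : I) (u : dsum A) : A i := u i.

Fact dsum_coord_is_zmod_morphism i : zmod_morphism (dsum_coord i).
Proof. by move=> u v; rewrite /dsum_coord /= !ffunE. Qed.

HB.instance Definition _ i := GRing.isZmodMorphism.Build (dsum A) (A i)
  (dsum_coord i) (dsum_coord_is_zmod_morphism i).

Lemma tuple_dsum_multiple (f g : forall i, A i) (n : int) :
  tuple_dsum f = tuple_dsum g *~ n <-> forall i, f i = g i *~ n.
Proof.
have coordE i h : dsum_coord i (tuple_dsum h) = h i by exact: ffunE.
split=> [fg i|fg]; first by rewrite -coordE fg raddfMz /= coordE.
apply/ffunP => i; change (dsum_coord i (tuple_dsum f) = dsum_coord i (tuple_dsum g *~ n)).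
by rewrite raddfMz /= !coordE.
Qed.

End DirectSum.

(** * Classes of stabilized configurations in the sandpile group *)

Section HatClass.
Variable G : multigraph.
Implicit Types u w : config G.

(** Toppling [x] adds the column of the reduced Laplacian at [x], the image of the indicator of
    [x]. *)
Lemma class_of_topple u (x : site G) :
  (deg (val x) <= u x)%N -> class_of (topple x u) = class_of u.
Proof.
move=> xu; apply/proj_eq/asboolP; exists [ffun y => (y == x)%:R].
apply/ffunP => z; rewrite !ffunE (bigD1 x) //= big1 => [|y /negPf yx].
  rewrite ffunE eqxx mulr1 addr0 /reduced_laplacian.
  have [->|_] := eqVneq z x; first by rewrite -subzn //; ring.
  by rewrite mult_sym PoszD; ring.
by rewrite ffunE yx mulr0.
Qed.

Lemma class_of_stabilize u : class_of (stabilize u) = class_of u.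
Proof.
(* The default of [xget] is [u] itself; otherwise the class is followed along the topplings. *)
rewrite /stabilize; case: xgetP => // w _ [_ [s [us <-]]].
elim: s u us => //= v s IH u /andP[/existsP[x /andP[xu /eqP vE]] vs].
by rewrite IH // vE class_of_topple.
Qed.

Lemma class_of_identity : class_of (identity G) = 0.
Proof.
rewrite /identity; case: xgetP => [e _ [] //|_].
(* Default case: the zero configuration has class [0]. *)
rewrite -[RHS](raddf0 (proj (@laplacian_lattice G))); congr (proj _ _).
by apply/ffunP => x; rewrite !ffunE.
Qed.

(** Stabilizing keeps the class and [identity] has class [0], so only the chip at [x] remains. From
    here on the sandpile group is used only as a cokernel. *)
Lemma hat_classE (x : site G) :
  hat_class x = proj (@laplacian_lattice G) [ffun y => (y == x)%:R].
Proof.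
rewrite /hat_class class_of_stabilize -[RHS]add0r -class_of_identity -raddfD.
by congr (proj _ _); apply/ffunP => y; rewrite !ffunE PoszD; case: (y == x).
Qed.

End HatClass.

(** * The Laplacian of a wired tree in terms of nodes *)

Section WiredLaplacian.
Variable S : rooted_tree.
Implicit Types (x y : S) (V : S -> int).

Lemma iter_parent_fixed n x : iter n.+1 (@parent S) x = x -> x = tree_root S.
Proof.
move=> nx; have /iter_findex := parent_connect x; set m := findex _ _ _ => mx.
have rootI k : iter k (@parent S) (tree_root S) = tree_root S.
  by elim: k => //= k ->; rewrite parent_root.
(* The root is [m] steps above [x]. Going [m] times round the cycle takes at least [m] steps, so it
   ends at the root, yet also at [x]. *)
have mnx : iter (m * n.+1) (@parent S) x = x.
  by elim: m {mx} => // m IH; rewrite mulSn iterD IH nx.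
by rewrite -[LHS]mnx mulnS addnC iterD mx rootI.
Qed.

Lemma is_child_antisym x y : ~~ (is_child x y && is_child y x).
Proof.
apply/negP => /andP[/andP[xr /eqP xy] /andP[_ /eqP yx]].
have /eqP : x = tree_root S by apply: (@iter_parent_fixed 1); rewrite /= xy.
by rewrite (negPf xr).
Qed.

Lemma sum_adj V x :
  \sum_(y | adj x y) V y =
  \sum_(y | is_child y x) V y + (if x == tree_root S then 0 else V (parent x)).
Proof.
rewrite (bigID (fun y => is_child y x)) /=; congr (_ + _).
  by apply: eq_bigl => y; rewrite /adj; case: (is_child y x); rewrite ?orbT ?andbF.
case: eqVneq => xr.
  rewrite big_pred0 // => y; rewrite /adj /is_child xr eqxx /=.
  by rewrite andbN.
rewrite (big_pred1 (parent x)) // => y /=; rewrite /adj.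
have := is_child_antisym x y; rewrite {1 3}/is_child xr /= eq_sym.
by case: eqVneq => //= _; case: (is_child y x).
Qed.

(* Leaves count as neighbours; taking [V = 0] on them models their collapse to
   the sink.  The last [- V x] is the edge from [x] to its parent or, at the
   root, the added edge to the sink. *)
Definition tree_laplacian V x : int :=
  \sum_(y | is_child y x) (V y - V x)
  + (if x == tree_root S then 0 else V (parent x)) - V x.

Definition site_node (p : site (wired_tree S)) : S :=
  if val p is Some z then val z else tree_root S.

Lemma site_node_nleaf p : ~~ leaf (site_node p).
Proof. by case: p => -[z|] //= pz; exact: (valP z). Qed.

(** Leaves collapse to the sink and [collapse] is injective on the other nodes, so the fibre over a
    site is a single node. *)
Lemma collapse_site p x : (collapse x == val p) = (x == site_node p).
Proof.
case: p => -[z|] //= pz; rewrite /site_node /collapse /=.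
case: insubP => [t _ <-|lx]; first by [].
by apply/esym/negP => /eqP xz; move: lx; rewrite xz; case: z {xz} => z /= ->.
Qed.

Lemma collapse_node p : collapse (site_node p) = val p.
Proof. by apply/eqP; rewrite collapse_site. Qed.

Lemma site_node_inj : injective site_node.
Proof.
move=> p q pq; apply: val_inj.
by rewrite -[LHS]collapse_node pq collapse_node.
Qed.

Lemma site_node_surj x : ~~ leaf x -> exists p, site_node p = x.
Proof.
by move=> xl; exists (exist (fun q : wired_vertex S => q != None) (Some (exist _ x xl)) isT).
Qed.

Lemma sum_site (R : nmodType) (F : S -> R) :
  \sum_(p : site (wired_tree S)) F (site_node p) = \sum_(x | ~~ leaf x) F x.
Proof.
rewrite (reindex_omap site_node (fun x => insub (collapse x))) /=.
  apply: eq_bigl => p; rewrite site_node_nleaf.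
  by rewrite collapse_node valK eqxx.
move=> x /site_node_surj[p <-].
by rewrite collapse_node valK.
Qed.

Lemma wired_multE p q :
  wired_mult (val p) q =
  (#|[pred y | adj (site_node p) y & collapse y == q]|
   + ((site_node p == tree_root S) && (q == None)))%N.
Proof.
rewrite /wired_mult; congr (_ + _)%N.
  have pairI : injective (pair (site_node p) : S -> S * S) by move=> y z [].
  rewrite -(card_image pairI); apply: eq_card => -[a b]; rewrite !inE /= collapse_site.
  have [->|ap] := eqVneq a (site_node p).
    by rewrite (fintype.mem_image pairI) inE.
  rewrite andbF; apply/esym/negP => /fintype.imageP[y _ [E _]].
  by rewrite E eqxx in ap.
congr nat_of_bool; rewrite [site_node p == _]eq_sym -collapse_site.
have -> : collapse (tree_root S) = wired_root_vertex S.
  by apply/eqP; rewrite (collapse_site (wired_root S)).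
by rewrite (negPf (valP p)) /= orbF eq_sym.
Qed.

Lemma mult_site p q : mult (val p) (val q) = adj (site_node p) (site_node q).
Proof.
rewrite [LHS]wired_multE (negPf (valP q)) andbF addn0.
rewrite (eq_card (_ : _ =i [pred y | (y == site_node q) && adj (site_node p) (site_node q)])).
  case: adj; last by rewrite eq_card0 // => y; rewrite !inE andbF.
  by rewrite (eq_card1 (x := site_node q)) // => y; rewrite !inE ?andbT.
move=> y; rewrite !inE collapse_site.
by case: eqVneq => [->|_]; rewrite ?andbT ?andbF.
Qed.

(** The extra one is the edge to the parent or, at the root, the added edge to the sink. *)
Lemma deg_site p : deg (val p) = (#|[pred y | is_child y (site_node p)]|).+1.
Proof.
rewrite /deg; under eq_bigr do rewrite [mult _ _]wired_multE.
rewrite big_split /= [X in (_ + X)%N](bigD1 None) //= andbT.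
rewrite [X in (_ + (_ + X))%N]big1 => [|[q|] // _]; last by rewrite andbF.
rewrite addn0.
under eq_bigr do rewrite -sum1_card.
(* The fibres of [collapse] partition the neighbours, leaves included. *)
rewrite -(partition_big (@collapse S) xpredT) //=.
(* Passing to integers allows [sum_adj] at the constant function [1]. *)
apply/eqP; rewrite -eqz_nat PoszD.
have -> : Posz (\sum_(y | adj (site_node p) y) 1) = \sum_(y | adj (site_node p) y) 1%:Z.
  by rewrite -[LHS]natz natr_sum.
rewrite sum_adj sumr_const natz [X in _ == X]intS [X in _ == X]addrC.
by apply/eqP; case: (_ == tree_root S); rewrite ?addr0.
Qed.

Lemma laplacian_site V p : (forall x, leaf x -> V x = 0) ->
  \sum_q reduced_laplacian p q * V (site_node q) = tree_laplacian V (site_node p).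
Proof.
move=> V0.
have -> : \sum_q reduced_laplacian p q * V (site_node q) =
   \sum_q (adj (site_node p) (site_node q))%:R * V (site_node q)
   - (deg (val p))%:Z * V (site_node p).
  rewrite [LHS](bigD1 p) //= [X in _ = X - _](bigD1 p) //= (negPf (adj_irr _)) mul0r add0r.
  rewrite /reduced_laplacian eqxx mulNr addrC; congr (_ - _).
  apply: eq_bigr => q; rewrite eq_sym => /negPf ->.
  by rewrite mult_site natz.
rewrite (sum_site (fun y => (adj (site_node p) y)%:R * V y)).
(* Leaves can be added to the sum because [V] vanishes on them. *)
have -> : \sum_(y | ~~ leaf y) (adj (site_node p) y)%:R * V y = \sum_(y | adj (site_node p) y) V y.
  rewrite [RHS]big_mkcond [LHS]big_mkcond; apply: eq_bigr => y _.
  by case: ifPn => [|/negPn/V0->]; case: adj; rewrite ?mul1r ?mul0r.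
rewrite sum_adj deg_site /tree_laplacian sumrB sumr_const intS mulrDl mul1r.
by rewrite -mulr_natl natz; ring.
Qed.

(** * Functions on the nodes as representatives of classes *)

Definition site_restrict (w : {ffun S -> int}) : {ffun site (wired_tree S) -> int} :=
  [ffun p => w (site_node p)].

Fact site_restrict_is_zmod_morphism : zmod_morphism site_restrict.
Proof. by move=> u v; apply/ffunP => p; rewrite !ffunE. Qed.

HB.instance Definition _ :=
  GRing.isZmodMorphism.Build _ _ site_restrict site_restrict_is_zmod_morphism.

Lemma site_restrict_surj u : exists w, site_restrict w = u.
Proof.
exists [ffun x => if [pick p | site_node p == x] is Some p then u p else 0].
apply/ffunP => p; rewrite !ffunE; case: pickP => [q /eqP /site_node_inj->//|/(_ p)].
by rewrite eqxx.
Qed.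

Lemma site_restrict_lattice (w : {ffun S -> int}) :
  site_restrict w \in @laplacian_lattice (wired_tree S) <->
  exists V, (forall x, leaf x -> V x = 0) /\
    (forall x, ~~ leaf x -> w x = tree_laplacian V x).
Proof.
split=> [/asboolP[v wE]|[V [V0 wE]]].
  pose V x := if [pick p | site_node p == x] is Some p then v p else 0.
  have V0 x : leaf x -> V x = 0.
    rewrite /V; case: pickP => // p /eqP <-; by rewrite (negPf (site_node_nleaf p)).
  exists V; split=> // _ /site_node_surj[p <-].
  rewrite -laplacian_site //; move/ffunP: wE => /(_ p); rewrite !ffunE => ->.
  apply: eq_bigr => q _; congr (_ * _); rewrite /V.
  by case: pickP => [r /eqP /site_node_inj->//|/(_ q)]; rewrite eqxx.
apply/asboolP; exists [ffun p => V (site_node p)].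
apply/ffunP => p; rewrite !ffunE wE ?site_node_nleaf // -laplacian_site //.
by apply: eq_bigr => q _; rewrite ffunE.
Qed.

Definition tree_class (w : {ffun S -> int}) : SP (wired_tree S) :=
  proj (@laplacian_lattice (wired_tree S)) (site_restrict w).

Fact tree_class_is_zmod_morphism : zmod_morphism tree_class.
Proof. by move=> u v; rewrite /tree_class !raddfB. Qed.

HB.instance Definition _ :=
  GRing.isZmodMorphism.Build _ _ tree_class tree_class_is_zmod_morphism.

Lemma tree_class_surj a : exists w, tree_class w = a.
Proof.
have [u <-] := proj_surj a; have [w <-] := site_restrict_surj u.
by exists w.
Qed.

Lemma root_hatE : root_hat S = tree_class [ffun x => (x == tree_root S)%:R].
Proof.
rewrite /root_hat hat_classE; congr (proj _ _); apply/ffunP => p; rewrite !ffunE.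
by congr (_%:R); rewrite -(inj_eq site_node_inj).
Qed.

(** Being [n] times the root generator becomes a linear system in which [n] enters only at the
    root. *)
Lemma tree_class_multiple (w : {ffun S -> int}) (n : int) :
  tree_class w = root_hat S *~ n <->
  exists V, (forall x, leaf x -> V x = 0) /\
    (forall x, ~~ leaf x ->
       w x = (if x == tree_root S then n else 0) + tree_laplacian V x).
Proof.
rewrite root_hatE -raddfMz proj_eq -raddfB site_restrict_lattice.
have E x : (w - [ffun x => (x == tree_root S)%:R] *~ n) x =
           w x - (if x == tree_root S then n else 0).
  rewrite !ffunE; congr (_ - _).
  have -> (m : int) (f : {ffun S -> int}) : (f *~ m) x = f x *~ m.
    by case: m => k; rewrite ?NegzE ?mulrNz ?ffunE -!pmulrn ffunMnE.
  by rewrite ffunE; case: eqP; rewrite ?mul0rz // intz.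
split=> -[V [V0 VE]]; exists V; split=> // x /VE; rewrite E.
  by move=> <-; rewrite addrC subrK.
by move=> ->; rewrite addrAC subrr add0r.
Qed.

End WiredLaplacian.

(** * The subtrees at the children of the root *)

Section ChildSubtrees.
Variable T : rooted_tree.
Local Notation r := (tree_root T).
Implicit Types (c : child r) (V : T -> int).

Lemma descendant_root (a : T) : descendant a r -> a = r.
Proof.
move=> /iter_findex; move: (findex _ _ _) => n <-.
by elim: n => //= n ->; rewrite parent_root.
Qed.

(** A path of positive length up to [a] would arrive from a child of [a], or from the root, which is
    its own parent. *)
Lemma leaf_descendant (a x : T) : leaf a -> descendant a x -> x = a.
Proof.
move=> /andP[ar /forallP al] /iter_findex.
case: (findex _ _ _) => [//|n] /= xa; have := al (iter n (@parent T) x).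
rewrite /is_child xa eqxx andbT negbK => /eqP xr.
by move: ar; rewrite -xa xr parent_root eqxx.
Qed.

Lemma child_neq_root c : val c != r.
Proof. by have /andP[] := valP c. Qed.

Lemma parent_child c : parent (val c) = r.
Proof. by have /andP[_ /eqP] := valP c. Qed.

Lemma child_ancestor (x : T) : x != r -> exists c, descendant (val c) x.
Proof.
have /iter_findex := parent_connect x; move: (findex _ _ _) => n.
elim: n x => [x /= ->|n IH x]; first by rewrite eqxx.
rewrite iterSr => /IH px xr.
have [pr|/px[c cx]] := eqVneq (parent x) r; last first.
  exists c; exact: (connect_trans (fconnect1 _ _) cx).
have xc : is_child x r by rewrite /is_child xr pr eqxx.
by exists (exist _ x xc); exact: connect0.
Qed.

(** Both children lie on the path from [x] to the root, one above the other; but any positive number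
    of steps up from a child of the root ends at the root. *)
Lemma child_ancestor_uniq (x : T) c c' :
  descendant (val c) x -> descendant (val c') x -> c = c'.
Proof.
move=> /iter_findex cx /iter_findex c'x; apply: val_inj.
move: cx c'x; move: (findex _ x (val c)) (findex _ x (val c')) => i j.
wlog ij : c c' i j / (i <= j)%N => [H ci c'j|].
  by have [ij|/ltnW ji] := leqP i j; [|apply/esym]; exact: H ci c'j || exact: H c'j ci.
move=> ci; rewrite -(subnK ij) iterD ci.
case: (j - i)%N => [//|k]; rewrite iterSr parent_child => kc'.
have /descendant_root : descendant (val c') r by rewrite -kc' /descendant fconnect_iter.
by move/eqP; rewrite (negPf (child_neq_root c')).
Qed.

Lemma glue_children (R : Type) (a : R) (W : child r -> T -> R) :
  exists f, f r = a /\ forall c x, descendant (val c) x -> f x = W c x.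
Proof.
exists (fun x => if [pick c : child r | descendant (val c) x] is Some c then W c x else a).
split=> [|c x cx].
  case: pickP => // c /descendant_root /eqP; by rewrite (negPf (child_neq_root c)).
case: pickP => [c' c'x|/(_ c)]; last by rewrite cx.
by rewrite (child_ancestor_uniq cx c'x).
Qed.

Variable c : child r.
Local Notation Tc := (subtree (val c)).
Implicit Types x y : Tc.

Lemma subtree_neq_root x : val x != r.
Proof.
apply: contraNneq (child_neq_root c) => xr.
by have := valP x; rewrite /= xr => /descendant_root /eqP.
Qed.

Lemma val_subtree_parent x : x != tree_root Tc -> val (parent x) = parent (val x).
Proof.
move=> xc; rewrite /= /subtree_parent (negPf xc) val_insubd.
(* The default of [insubd] is never reached: as [x] differs from [c], the path from [x] up to [c]
   passes through the parent of [x]. *)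
case: ifP => // /negP[]; have /iter_findex := valP x.
case: findex => [|n] /= xcE; first by rewrite -val_eqE /= xcE eqxx in xc.
by rewrite -[X in descendant X _]xcE -iterS iterSr /descendant fconnect_iter.
Qed.

Lemma subtree_is_child x y : is_child y x = is_child (val y) (val x).
Proof.
rewrite /is_child; have [->|yc] := eqVneq y (tree_root Tc).
  by rewrite /= parent_child [r == _]eq_sym (negPf (subtree_neq_root x)) andbF.
by rewrite subtree_neq_root -val_eqE val_subtree_parent.
Qed.

Lemma child_descendant (y : T) x : is_child y (val x) -> descendant (val c) y.
Proof.
move=> /andP[_ /eqP yx]; apply: connect_trans (fconnect1 _ _) _.
by rewrite yx; exact: (valP x).
Qed.

(** The side condition matters when [c] is a leaf of [T]: as a root it is not a leaf of its own
    subtree. *)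
Lemma subtree_leaf x : leaf x = (x != tree_root Tc) && leaf (val x).
Proof.
rewrite /leaf; have [//|xc] := eqVneq x (tree_root Tc).
rewrite subtree_neq_root /=; apply/forallP/forallP => H y; last by rewrite subtree_is_child.
apply/negP => yx; have := H (exist _ y (child_descendant yx)).
by rewrite subtree_is_child /= yx.
Qed.

(** The edge from [c] to [r] becomes the edge from [c] to the sink: the degree is kept, but the
    neighbouring value [V r] drops to [0]. *)
Lemma subtree_laplacian V x :
  tree_laplacian V (val x) =
  tree_laplacian (fun y : Tc => V (val y)) x + (if x == tree_root Tc then V r else 0).
Proof.
rewrite /tree_laplacian.
have -> : \sum_(y | is_child y (val x)) (V y - V (val x)) =
          \sum_(y | is_child y x) (V (val y) - V (val x)).
  rewrite (reindex_omap (val : Tc -> T) insub) /= => [|y yx].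
    by apply: eq_bigl => y; rewrite valK eqxx andbT subtree_is_child.
  by rewrite insubT //; exact: child_descendant yx.
rewrite (negPf (subtree_neq_root x)).
have [->|xc] := eqVneq x (tree_root Tc); last by rewrite /= val_subtree_parent // addr0.
by rewrite parent_child /=; ring.
Qed.

Definition restrict_subtree (w : {ffun T -> int}) : {ffun Tc -> int} :=
  [ffun x => w (val x)].

End ChildSubtrees.

(** * Comparison of the two kernels *)

Section Comparison.
Variable T : rooted_tree.
Local Notation r := (tree_root T).
Local Notation hats := (tuple_dsum (fun c : child r => root_hat (subtree (val c)))).
Implicit Types w : {ffun T -> int}.

Definition to_quot_root w : quot_cyclic (root_hat T) :=
  proj (multiples (root_hat T)) (tree_class w).

Definition to_quot_children w : quot_cyclic hats :=
  proj (multiples hats)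
    (tuple_dsum (fun c : child r => tree_class (restrict_subtree c w))).

Fact to_quot_root_is_zmod_morphism : zmod_morphism to_quot_root.
Proof. by move=> u v; rewrite /to_quot_root !raddfB. Qed.

Fact to_quot_children_is_zmod_morphism : zmod_morphism to_quot_children.
Proof.
move=> u v; rewrite /to_quot_children -raddfB; congr (proj _ _).
apply/ffunP => c; rewrite !ffunE -raddfB; congr tree_class.
by apply/ffunP => x; rewrite !ffunE.
Qed.

HB.instance Definition _ :=
  GRing.isZmodMorphism.Build _ _ to_quot_root to_quot_root_is_zmod_morphism.
HB.instance Definition _ :=
  GRing.isZmodMorphism.Build _ _ to_quot_children to_quot_children_is_zmod_morphism.

Lemma to_quot_root_surj q : exists w, to_quot_root w = q.
Proof.
have [a <-] := proj_surj q; have [w <-] := tree_class_surj a.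
by exists w.
Qed.

Lemma extend_subtree (c : T) (R : Type) (a : R) (f : subtree c -> R) :
  exists W : T -> R, forall x, W (val x) = f x.
Proof.
by exists (fun x => if insub x is Some z then f z else a) => x; rewrite valK.
Qed.

Lemma to_quot_children_surj q : exists w, to_quot_children w = q.
Proof.
have [a <-] := proj_surj q.
have /choice[W WE] (c : child r) : exists W : T -> int,
    tree_class [ffun x : subtree (val c) => W (val x)] = a c.
  have [f <-] := tree_class_surj (a c); have [W WE] := extend_subtree 0 f.
  by exists W; congr tree_class; apply/ffunP => x; rewrite ffunE WE.
have [V [_ VE]] := glue_children 0 W.
exists [ffun x => V x]; congr (proj _ _); apply/ffunP => c; rewrite ffunE -WE.
congr tree_class; apply/ffunP => x; rewrite !ffunE; exact: VE (valP x).
Qed.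

Definition laplacian_solvable w := exists V, (forall x, leaf x -> V x = 0) /\
  forall x, x != r -> ~~ leaf x -> w x = tree_laplacian V x.

Lemma to_quot_root_eq0 w : to_quot_root w = 0 <-> laplacian_solvable w.
Proof.
rewrite proj_cyclic_eq0; split=> [[n /tree_class_multiple[V [V0 VE]]]|[V [V0 VE]]].
  by exists V; split=> // x /negPf xr /VE; rewrite xr add0r.
(* The multiple of the generator is the defect in the equation at [r]. *)
exists (w r - tree_laplacian V r); apply/tree_class_multiple; exists V; split=> // x xl.
by have [->|xr] := eqVneq x r; rewrite ?subrK // add0r VE.
Qed.

Lemma to_quot_children_eq0 w : to_quot_children w = 0 <-> laplacian_solvable w.
Proof.
rewrite proj_cyclic_eq0; split=> [[n wn]|[V [V0 VE]]].
  have /choice[W WP] (c : child r) : exists W : T -> int,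
      (forall x : subtree (val c), leaf x -> W (val x) = 0) /\
      forall x : subtree (val c), ~~ leaf x -> w (val x) =
        (if x == tree_root (subtree (val c)) then n else 0)
        + tree_laplacian (fun y : subtree (val c) => W (val y)) x.
    have : tree_class (restrict_subtree c w) = root_hat (subtree (val c)) *~ n.
      by move/tuple_dsum_multiple: wn; apply.
    move=> /tree_class_multiple[f [f0 fE]]; have [W WE] := extend_subtree 0 f.
    have {}WE : (fun y => W (val y)) = f by apply/funext.
    exists W; rewrite -WE in f0 fE; split=> // x /fE; by rewrite ffunE.
  (* The multiple [n] becomes the value at [r]. Zero is forced on the leaves of [T] because a child
     of [r] that is a leaf of [T] is not a leaf of its subtree, so [W] need not vanish there. *)
  have [V [Vr VE]] := glue_children n (fun c x => if leaf x then 0 else W c x).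
  exists V; split=> [x lx|x xr xl].
    have xr : x != r by case/andP: lx.
    by have [c cx] := child_ancestor xr; rewrite (VE c) // lx.
  have [c cx] := child_ancestor xr.
  pose y : subtree (val c) := exist _ x cx.
  have yl : ~~ leaf y by rewrite subtree_leaf (negPf xl) andbF.
  rewrite -[x]/(val y) [LHS](WP c).2 // [RHS](subtree_laplacian V y) addrC Vr; congr (_ + _).
  (* Since [c] lies above an internal node it is not a leaf, so forcing zeros changes nothing on
     this subtree. *)
  have cl : ~~ leaf (val c).
    by apply: contraNN xl => cl; rewrite (leaf_descendant cl cx).
  have VW (z : subtree (val c)) : V (val z) = W c (val z).
    rewrite (VE c); last exact: valP.
    case: ifP => // zl; rewrite (WP c).1 // subtree_leaf zl andbT.
    by apply: contraNneq cl => zc; rewrite zc in zl.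
  by congr tree_laplacian; apply/funext.
(* Conversely the value at [r] serves as the multiple, common to all the children. *)
exists (V r); apply/tuple_dsum_multiple => c; apply/tree_class_multiple.
have [lc|cl] := boolP (leaf (val c)).
  (* The wired subtree of a leaf is a single edge: its group is trivial. *)
  have allroot (x : subtree (val c)) : x = tree_root (subtree (val c)).
    by apply: val_inj; exact: leaf_descendant lc (valP x).
  (* On a single node the Laplacian of a constant [v] is [- v]; this solves
     [w (val c) = V r - v]. *)
  exists (fun=> V r - w (val c)); split=> x; first by rewrite /leaf (allroot x) eqxx.
  rewrite ffunE /tree_laplacian (allroot x) eqxx /= => _.
  by rewrite big1 => [|y _]; rewrite ?subrr //; ring.
exists (fun x => V (val x)); split=> [x|x xl].
  by rewrite subtree_leaf => /andP[_ /V0].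
have xl' : ~~ leaf (val x).
  apply: contraNN xl => lx; rewrite subtree_leaf lx andbT.
  by apply: contraNneq cl => xc; rewrite xc in lx.
by rewrite ffunE VE ?subtree_neq_root // subtree_laplacian addrC.
Qed.

End Comparison.

Theorem theorem3p4 (T : rooted_tree) :
  zmod_isog
    (quot_cyclic (root_hat T))
    (quot_cyclic
       (tuple_dsum (fun c : child (tree_root T) => root_hat (subtree (val c))))).
Proof.
apply: (zmod_isog_same_kernel (f := @to_quot_root T) (g := @to_quot_children T)).
- exact: to_quot_root_surj.
- exact: to_quot_children_surj.
- by move=> w; rewrite to_quot_root_eq0 to_quot_children_eq0.
Qed.
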